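(* Let $m>n\geq 4$ and let $G$ be a connected graph with $n$ vertices and $m$ edges. Then $S(G)\leq S_{\mathcal{L}}(G)$, and the equality $S(G)=S_{\mathcal{L}}(G)$ holds if and only if $G$ is a regular bipartite graph.
   Context: Graphs are finite, simple and undirected. $S(G)$ is the spread of $G$: the difference between the largest and the smallest eigenvalue of the adjacency matrix $A(G)$. The line graph $\mathcal{L}(G)$ has the edges of $G$ as vertices, two being adjacent if the corresponding edges of $G$ share a common vertex. $S_{\mathcal{L}}(G)$ is the spread of the line graph: the largest minus the smallest eigenvalue of the adjacency matrix of $\mathcal{L}(G)$. *)

(* Defs.v *)
From mathcomp Require Import all_boot all_order all_algebra.
From mathcomp Require Import classical_sets reals.
From mathcomp Require Import complex polyrcf.
Set Implicit Arguments.
Unset Strict Implicit.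
Unset Printing Implicit Defensive.
Import Order.TTheory GRing.Theory Num.Theory.
Local Open Scope ring_scope.

Record sgraph := SGraph {
  vertex :> finType;
  adj : rel vertex;
  adj_sym : symmetric adj;
  adj_irrefl : irreflexive adj }.

Arguments adj {s} : rename.

Definition edges (G : sgraph) : {set {set G}} :=
  [set [set x; y] | x in G, y in G & adj x y].

Definition connected (G : sgraph) : Prop := forall x y : G, connect adj x y.

Definition regular (G : sgraph) : Prop :=
  exists k : nat, forall x : G, #|[set y | adj x y]| = k.

(* A and its complement are the two colour classes. *)
Definition bipartite (G : sgraph) : Prop :=
  exists A : {set G}, forall x y : G, adj x y -> (x \in A) != (y \in A).

Definition edge_type (G : sgraph) : finType := {E : {set G} | E \in edges G}.

Definition line_adj (G : sgraph) : rel (edge_type G) :=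
  fun E F => (E != F) && ~~ [disjoint val E & val F].

Lemma line_adj_sym G : symmetric (@line_adj G).
Proof. by move=> E F; rewrite /line_adj eq_sym disjoint_sym. Qed.

Lemma line_adj_irrefl G : irreflexive (@line_adj G).
Proof. by move=> E; rewrite /line_adj eqxx. Qed.

Definition line_graph (G : sgraph) : sgraph :=
  SGraph (@line_adj_sym G) (@line_adj_irrefl G).

Section Spread.
Variable R : realType.

Definition adjmx (G : sgraph) : 'M[R]_#|G| :=
  \matrix_(i, j) (adj (enum_val i) (enum_val j))%:R.

(* The set of eigenvalues is finite, so the supremum and the infimum are the
   largest and the smallest eigenvalue as soon as an eigenvalue exists;
   see max_eigenvalueP and min_eigenvalueP. *)
Definition max_eigenvalue n (A : 'M[R]_n) : R :=
  sup [set a | eigenvalue A a]%classic.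

Definition min_eigenvalue n (A : 'M[R]_n) : R :=
  inf [set a | eigenvalue A a]%classic.

Definition spread (G : sgraph) : R :=
  max_eigenvalue (adjmx G) - min_eigenvalue (adjmx G).

Lemma adjmx_sym G : (adjmx G)^T = adjmx G.
Proof. by apply/matrixP => i j; rewrite !mxE adj_sym. Qed.

Lemma card_line_graph G : #|line_graph G| = #|edges G|.
Proof. exact: card_sig. Qed.

Lemma symmx_eigenvalue n (A : 'M[R]_n) :
  (0 < n)%N -> A^T = A -> exists a, eigenvalue A a.
Proof.
case: n A => // n A _ symA; pose f := real_complex R.
have [lam] : exists lam, root (char_poly (map_mx f A)) lam.
  by apply/closed_rootP; rewrite size_char_poly.
rewrite -eigenvalue_root_char => eigA.
have /eigenvalueP[v vA v_neq0] := eigA.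
pose w := map_mx Num.conj v.
have wA : w *m map_mx f A = lam^* *: w.
  rewrite -map_mxZ -vA map_mxM; congr (_ *m _).
  apply/matrixP => i j; rewrite !mxE.
  by apply/esym/CrealP/complex_realP; exists (A i j).
have lamE : lam *: (v *m w^T) = lam^* *: (v *m w^T).
  rewrite scalemxAl -vA -mulmxA [RHS]scalemxAr -linearZ/= -wA trmx_mul.
  by congr (_ *m (_ *m _)); rewrite -{1}symA; apply/matrixP => i j; rewrite !mxE.
have vw_neq0 : (v *m w^T) 0 0 != 0.
  rewrite mxE; under eq_bigr do rewrite !mxE -normCK.
  rewrite psumr_eq0 => [|i _]; last exact: exprn_ge0.
  apply: contra v_neq0 => /allP v0; apply/eqP/rowP => j; rewrite mxE.
  by apply/eqP; have := v0 j (mem_index_enum _); rewrite sqrf_eq0 normr_eq0.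
have /esym lam_conj : lam = lam^*.
  by move/matrixP/(_ 0 0): lamE; rewrite mxE [RHS]mxE => /(mulIf vw_neq0).
have /complex_realP[a aE] : lam \is Num.real by apply/CrealP; rewrite lam_conj.
by exists a; move: eigA; rewrite aE (eigenvalue_map f).
Qed.

Lemma seq_max (s : seq R) : s != [::] ->
  exists2 M, M \in s & forall x, x \in s -> x <= M.
Proof.
elim: s => // x [_ _|y s /(_ isT) [M Ms leM] _].
  by exists x => [|z]; rewrite inE // => /eqP ->.
case: (leP x M) => xM.
  by exists M => [|z]; rewrite inE ?Ms ?orbT // => /predU1P[->|/leM].
exists x => [|z]; rewrite inE ?eqxx // => /predU1P[->//|/leM /le_trans].
by apply; exact: ltW.
Qed.

Lemma max_eigenvalueP n (A : 'M[R]_n) : (0 < n)%N -> A^T = A ->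
  eigenvalue A (max_eigenvalue A) /\
  (forall a, eigenvalue A a -> a <= max_eigenvalue A).
Proof.
move=> n_gt0 symA; have [a0 Aa0] := symmx_eigenvalue n_gt0 symA.
have ers a : eigenvalue A a = (a \in rootsR (char_poly A)).
  rewrite eigenvalue_root_char -roots_on_rootsR ?in_itv //=.
  by rewrite monic_neq0 ?char_poly_monic.
have [|M] := @seq_max (rootsR (char_poly A)).
  by apply: contraTneq Aa0 => s0; rewrite ers s0.
rewrite -ers => AM leM.
suff -> : max_eigenvalue A = M by split => // a; rewrite ers => /leM.
apply/eqP; rewrite eq_le; apply/andP; split.
  by apply: ge_sup; [exists M | move=> a /=; rewrite ers => /leM].
by apply: ub_le_sup => //; exists M => a /=; rewrite ers => /leM.
Qed.

Lemma max_eigenvalueN n (A : 'M[R]_n) :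
  max_eigenvalue (- A) = - min_eigenvalue A.
Proof.
rewrite /min_eigenvalue /inf opprK /max_eigenvalue; congr sup.
apply/seteqP; split => [a /eigenvalueP[v vA v0]|a [b /eigenvalueP[v vA v0] <-]].
  exists (- a); rewrite ?opprK //; apply/eigenvalueP; exists v => //.
  by rewrite scaleNr -vA mulmxN opprK.
by apply/eigenvalueP; exists v => //; rewrite mulmxN vA scaleNr.
Qed.

Lemma min_eigenvalueP n (A : 'M[R]_n) : (0 < n)%N -> A^T = A ->
  eigenvalue A (min_eigenvalue A) /\
  (forall a, eigenvalue A a -> min_eigenvalue A <= a).
Proof.
have evN (B : 'M[R]_n) a : eigenvalue (- B) a = eigenvalue B (- a).
  apply/eigenvalueP/eigenvalueP => -[v vB v0]; exists v => //.
    by rewrite scaleNr -vB mulmxN opprK.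
  by rewrite mulmxN vB scaleNr opprK.
move=> n_gt0 symA; have [|+ leM] := @max_eigenvalueP n (- A) n_gt0.
  by rewrite linearN /= symA.
rewrite evN max_eigenvalueN opprK => Am; split => // a Aa.
by rewrite -lerN2 -max_eigenvalueN leM // evN opprK.
Qed.

End Spread.

Arguments spread : clear implicits.

(* Main.v *)
Require Import Defs.
From mathcomp Require Import all_boot all_order all_algebra reals.
From mathcomp Require Import complex ring lra.
Set Implicit Arguments.
Unset Strict Implicit.
Unset Printing Implicit Defensive.
Import Order.TTheory GRing.Theory Num.Theory.
Local Open Scope ring_scope.

(** Write [L] for the line graph of [G], [B] for the vertex-edge incidence matrix
    and [t] for the largest eigenvalue of [L] plus 2. Since [B^T B = 2 + A(L)]
    ([end_star_sum]), every eigenvalue of [L] is at least -2, and -2 occurs because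
    [m > n] forces a nonzero [g] with [B g = 0]. So the spread of [L] is [t]
    ([min_eigenvalue_line]).

    On the other side, [B^T B] and the signless Laplacian [B B^T = D + A(G)] have
    the same largest eigenvalue [t], so that for every function [u] on the vertices
      [\sum_(x ~ y) (u x + u y) ^+ 2 <= 2 * t * \sum_x u x ^+ 2]
    over ordered pairs of adjacent vertices ([sum_adj_sqr_le]). For an eigenfunction
    [u] of [G] with eigenvalue [a], the sum of [u x * u y] over the same pairs is
    [a * \sum_x u x ^+ 2]. Comparing [4 * (u x * u y)] with [(u x + u y) ^+ 2] gives
    [2 * a <= t] ([eigenvalue_le_line]); comparing [- 4 * (u x * u y)] with
    [(`|u x| + `|u y|) ^+ 2] gives [- (2 * a) <= t] ([eigenvalue_ge_line]). The
    spread of [G] is thus at most [t / 2 + t / 2].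

    Equality forces equality in the second comparison for the least eigenvalue, hence
    [u y = - u x] on every edge ([adj_opposite]). By connectedness [`|u|] is
    constant, the sign of [u] is a 2-colouring, and the eigenvalue equation reads
    [- deg x = a] ([opposite_regular_bipartite]). Conversely, a [k]-regular
    bipartite graph has the eigenvalues [k] and [- k], while [D = k] gives
    [t <= 2 * k] ([regular_max_eigenvalue_line]). *)

(** * Rayleigh quotients *)

(** Over the complex numbers a real symmetric matrix is unitarily diagonalisable
    with real eigenvalues, which makes both sides weighted sums of the squared
    moduli of the coordinates of [v] in an orthonormal eigenbasis. *)
Lemma rayleigh_le (R : realType) n (A : 'M[R]_n) (v : 'rV[R]_n) :
  (0 < n)%N -> A^T = A ->
  (v *m A *m v^T) 0 0 <= max_eigenvalue A * (v *m v^T) 0 0.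
Proof.
move=> n_gt0 symA; have [_ leM] := max_eigenvalueP n_gt0 symA.
pose f := real_complex R; pose Ac := map_mx f A.
have conjf m p (B : 'M[R]_(m, p)) : map_mx Num.conj (map_mx f B) = map_mx f B.
  apply/matrixP => i j; rewrite !mxE.
  by apply/CrealP/complex_realP; exists (B i j).
have AcH : Ac \is hermsymmx.
  by apply/is_hermitianmxP; rewrite expr0 scale1r -map_trmx conjf map_trmx symA.
have Pu := spectral_unitarymx Ac.
have /orthomx_spectralP := hermitian_normalmx AcH.
have /mxOverP d_real := hermitian_spectral_diag_real AcH.
move: (spectral_diag Ac) (spectralmx Ac) Pu d_real => d P Pu d_real AcE.
(* Row [i] of the unitary matrix is an eigenvector for the real number [d 0 i]. *)
have dE i : exists2 r, d 0 i = f r & r <= max_eigenvalue A.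
  have /complex_realP[r rE] := d_real 0 i; exists r => //.
  apply: leM; rewrite -(eigenvalue_map f); apply/eigenvalueP.
  exists (row i P); last first.
    apply/negP => /eqP Pi0; move: (unitarymx_unit Pu).
    rewrite -row_free_unit => /row_freeP[Q] /(congr1 (row i)).
    rewrite row_mul Pi0 mul0mx => /rowP/(_ i)/eqP.
    by rewrite !mxE eqxx eq_sym oner_eq0.
  rewrite -/Ac AcE !mulmxA -row_mul mulmxV ?unitarymx_unit //.
  by rewrite row1 -rowE row_diag_mx rE -scalemxAl -rowE.
pose w := map_mx f v *m invmx P.
have wT : map_mx Num.conj w^T = P *m (map_mx f v)^T.
  rewrite trmx_mul map_mxM invmx_unitary //; congr (_ *m _).
    apply/matrixP => i j; rewrite !mxE.
    exact: conjCK.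
  by rewrite map_trmx conjf.
suff: f ((v *m A *m v^T) 0 0) <= f (max_eigenvalue A) * f ((v *m v^T) 0 0).
  by rewrite -rmorphM lecR.
have -> : f ((v *m A *m v^T) 0 0) = \sum_i d 0 i * `|w 0 i| ^+ 2.
  have -> : f ((v *m A *m v^T) 0 0) = (w *m diag_mx d *m map_mx Num.conj w^T) 0 0.
    have wP : w *m diag_mx d *m P = map_mx f v *m Ac by rewrite AcE !mulmxA.
    rewrite wT mulmxA wP map_trmx.
    by rewrite -!map_mxM [RHS]mxE.
  rewrite mxE; apply: eq_bigr => i _; rewrite mul_mx_diag !mxE normCK; ring.
have -> : f ((v *m v^T) 0 0) = \sum_i `|w 0 i| ^+ 2.
  have -> : f ((v *m v^T) 0 0) = (w *m map_mx Num.conj w^T) 0 0.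
    rewrite wT mulmxA mulmxKV ?unitarymx_unit // map_trmx.
    by rewrite -!map_mxM [RHS]mxE.
  by rewrite mxE; apply: eq_bigr => i _; rewrite !mxE normCK.
rewrite mulr_sumr; apply: ler_sum => i _; apply: ler_wpM2r; first exact: exprn_ge0.
by have [r -> ler] := dE i; rewrite lecR.
Qed.

(** * Eigenvalues through functions on the vertices *)

Section Eigenfunctions.
Variable R : realType.

Definition adj_sum (G : sgraph) (u : G -> R) (x : G) : R := \sum_(y | adj x y) u y.

Definition rowfun (G : sgraph) (u : G -> R) : 'rV[R]_#|G| :=
  \row_i u (enum_val i).

Lemma sum_enum_val (T : finType) (F : T -> R) :
  \sum_(i < #|T|) F (enum_val i) = \sum_x F x.
Proof. by rewrite [RHS]big_enum_val. Qed.

Lemma rowfun_adjmx (G : sgraph) (u : G -> R) :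
  rowfun u *m adjmx R G = rowfun (adj_sum u).
Proof.
apply/rowP => j; rewrite !mxE /adj_sum [RHS]big_mkcond -[RHS]sum_enum_val.
apply: eq_bigr => i _; rewrite !mxE adj_sym.
by case: ifP => _; rewrite ?mulr1 ?mulr0.
Qed.

Lemma rowfun_dot (G : sgraph) (u w : G -> R) :
  (rowfun u *m (rowfun w)^T) 0 0 = \sum_x u x * w x.
Proof. by rewrite mxE -[RHS]sum_enum_val; apply: eq_bigr => i _; rewrite !mxE. Qed.

Lemma eigenfunctionP (G : sgraph) (a : R) :
  reflect (exists u : G -> R, (exists x, u x != 0) /\ adj_sum u =1 (fun x => a * u x))
          (eigenvalue (adjmx R G) a).
Proof.
apply: (iffP eigenvalueP) => [[v vA v_neq0]|[u [[x ux] uA]]].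
  pose u x := v 0 (enum_rank x).
  have vE : v = rowfun u by apply/rowP => i; rewrite mxE /u enum_valK.
  exists u; split.
    apply/existsP; apply: contraNT v_neq0; rewrite negb_exists => /forallP u0.
    by apply/eqP/rowP => i; rewrite vE !mxE; apply/eqP; rewrite -[_ == _]negbK.
  move=> x; move/rowP/(_ (enum_rank x)): vA.
  by rewrite vE rowfun_adjmx !mxE enum_rankK.
exists (rowfun u); last first.
  by apply: contraNneq ux => /rowP/(_ (enum_rank x)); rewrite !mxE enum_rankK => ->.
by rewrite rowfun_adjmx; apply/rowP => i; rewrite !mxE.
Qed.

Lemma rayleigh_adj (G : sgraph) (u : G -> R) : (0 < #|G|)%N ->
  \sum_x u x * adj_sum u x <= max_eigenvalue (adjmx R G) * \sum_x u x ^+ 2.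
Proof.
move=> G_gt0; have := rayleigh_le (rowfun u) G_gt0 (adjmx_sym R G).
rewrite rowfun_adjmx !rowfun_dot => le_u.
under eq_bigr do rewrite mulrC; exact: le_u.
Qed.

Lemma eigenfunction_dot (G : sgraph) (u : G -> R) a :
  adj_sum u =1 (fun x => a * u x) ->
  \sum_x u x * adj_sum u x = a * \sum_x u x ^+ 2.
Proof.
by move=> uA; rewrite mulr_sumr; apply: eq_bigr => x _; rewrite uA; ring.
Qed.

Lemma sum_sqr_gt0 (T : finType) (u : T -> R) :
  (exists x, u x != 0) -> 0 < \sum_x u x ^+ 2.
Proof.
move=> [x ux]; rewrite (bigD1 x) //= ltr_wpDr ?exprn_even_gt0 //.
by apply: sumr_ge0 => y _; exact: sqr_ge0.
Qed.

End Eigenfunctions.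

(** * The incidence structure of a graph and its line graph *)

Section Incidence.
Variables (R : realType) (G : sgraph).
Local Notation L := (line_graph G).

(** With [B] the incidence matrix, [end_sum u] is [B^T u] and [star_sum g] is
    [B g]. *)
Definition end_sum (u : G -> R) (E : L) : R := \sum_(x in val E) u x.
Definition star_sum (g : L -> R) (x : G) : R := \sum_(E : L | x \in val E) g E.

Lemma end_star_adj (u : G -> R) (g : L -> R) :
  \sum_E end_sum u E * g E = \sum_x u x * star_sum g x.
Proof.
under eq_bigr do rewrite mulr_suml big_mkcond.
rewrite exchange_big; apply: eq_bigr => x _.
by rewrite mulr_sumr [RHS]big_mkcond.
Qed.

Lemma edgeP (E : {set G}) :
  reflect (exists x y, adj x y /\ E = [set x; y]) (E \in edges G).
Proof.
apply: (iffP imset2P) => [[x y _]|[x [y [xy ->]]]].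
  by rewrite inE => /andP[_ xy] ->; exists x, y.
by exists x y => //; rewrite inE.
Qed.

Lemma adj_neq (x y : G) : adj x y -> x != y.
Proof. by apply: contraTneq => ->; rewrite adj_irrefl. Qed.

Lemma card_edge (E : L) : #|val E| = 2.
Proof.
by have /edgeP[x [y [/adj_neq xy ->]]] := valP E; rewrite cards2 xy.
Qed.

(** Two distinct edges of a simple graph share at most one vertex, so the number
    of common vertices is exactly the adjacency in the line graph. *)
Lemma card_edgeI (E F : L) : E != F -> #|val E :&: val F| = adj E F.
Proof.
move=> EF; rewrite /adj /= /line_adj EF /= -setI_eq0 -card_gt0.
suff : (#|val E :&: val F| < 2)%N by case: #|_| => [|[]].
rewrite ltnNge; apply: contra EF => I2; rewrite -val_eqE eqEcard.
rewrite !card_edge leqnn andbT; apply/setIidPl/eqP.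
by rewrite eqEcard subsetIl card_edge.
Qed.

(** The identity [B^T B = 2 + A(L)]: an edge meets itself in 2 vertices and an
    adjacent edge in one. *)
Lemma end_star_sum (g : L -> R) (E : L) :
  end_sum (star_sum g) E = 2 * g E + adj_sum g E.
Proof.
rewrite /end_sum /star_sum.
under eq_bigr do rewrite big_mkcond.
rewrite exchange_big (bigD1 E) //=; congr (_ + _).
  under eq_bigr do rewrite ifT //.
  by rewrite sumr_const card_edge mulr_natl.
rewrite /adj_sum big_mkcond [RHS]big_mkcond; apply: eq_bigr => F _.
case: (eqVneq F E) => [->|FE] /=; first by rewrite line_adj_irrefl.
rewrite -big_mkcondr /= sumr_const.
rewrite (eq_card (B := val E :&: val F)) => [|x]; last by rewrite !inE.
by rewrite card_edgeI 1?eq_sym // mulrb.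
Qed.

(** The quadratic form of [B^T B = 2 + A(L)], which is what bounds the
    eigenvalues of the line graph. *)
Lemma sum_star_sqr (g : L -> R) :
  \sum_x star_sum g x ^+ 2 = 2 * \sum_E g E ^+ 2 + \sum_E g E * adj_sum g E.
Proof.
under eq_bigr do rewrite expr2.
rewrite -end_star_adj mulr_sumr -big_split; apply: eq_bigr => E _ /=.
by rewrite end_star_sum; ring.
Qed.

(** Each edge comes from two ordered pairs of adjacent vertices, whence the
    factor 2. *)
Lemma sum_edges (F : {set G} -> R) :
  \sum_x \sum_(y | adj x y) F [set x; y] = 2 * \sum_(E : L) F (val E).
Proof.
have -> : \sum_(E : L) F (val E) = \sum_(E in edges G) F E.
  exact: esym (big_sub (mem (edges G)) F).
rewrite pair_big_dep /= (partition_big (fun p => [set p.1; p.2]) [in edges G]) /=; last first.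
  by move=> [x y] /= xy; apply/edgeP; exists x, y.
rewrite mulr_sumr; apply: eq_bigr => E /edgeP[a [b [ab ->]]].
rewrite (eq_bigr (fun=> F [set a; b])) => [|p /andP[_ /eqP -> //]].
rewrite sumr_const (eq_card (B := [set (a, b); (b, a)])) => [|[x y]].
  by rewrite cards2 xpair_eqE (negbTE (adj_neq ab)) mulr_natl.
rewrite !inE /= !xpair_eqE unfold_in /=.
apply/andP/orP => [[xy /eqP xyE]|[|] /andP[/eqP -> /eqP ->]]; last 2 first.
- by rewrite ab.
- by rewrite adj_sym ab setUC.
have : x \in [set a; b] by rewrite -xyE !inE eqxx.
have : y \in [set a; b] by rewrite -xyE !inE eqxx orbT.
rewrite !inE => /orP[] /eqP yE /orP[] /eqP xE; subst; rewrite ?eqxx; auto.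
  by rewrite adj_irrefl in xy.
by rewrite adj_irrefl in xy.
Qed.

Lemma sum_end_sqr (u : G -> R) :
  2 * \sum_E end_sum u E ^+ 2 = \sum_x \sum_(y | adj x y) (u x + u y) ^+ 2.
Proof.
rewrite -(sum_edges (fun E => (\sum_(x in E) u x) ^+ 2)).
apply: eq_bigr => x _; apply: eq_bigr => y xy.
by rewrite big_setU1 ?inE ?adj_neq // big_set1.
Qed.

End Incidence.

(** * Eigenvalues of a graph against those of its line graph *)

Section Spectra.
Variable R : realType.
Implicit Type G : sgraph.

(** The diagonal of the adjacency matrix is zero, so the indicator function of a
    vertex has Rayleigh quotient 0. *)
Lemma max_eigenvalue_ge0 G : (0 < #|G|)%N -> 0 <= max_eigenvalue (adjmx R G).
Proof.
move=> G_gt0; have /card_gt0P[x0 _] := G_gt0.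
have := rayleigh_adj (fun x : G => (x == x0)%:R : R) G_gt0.
rewrite big1 => [|x _]; last first.
  case: eqP => [->|_]; rewrite ?mul0r // mul1r /adj_sum big1 // => y xy.
  by case: eqP => // y0; rewrite y0 adj_irrefl in xy.
rewrite pmulr_lge0 //; apply: sum_sqr_gt0.
by exists x0; rewrite eqxx oner_neq0.
Qed.

(** For an eigenfunction [g], [(2 + a) * \sum_E g E ^+ 2] is the squared norm
    of [star_sum g]. *)
Lemma line_eigenvalue_ge G a : eigenvalue (adjmx R (line_graph G)) a -> -2 <= a.
Proof.
move=> /eigenfunctionP[g [/sum_sqr_gt0 g_gt0 gA]].
have := sum_star_sqr g; rewrite (eigenfunction_dot gA) -mulrDl => starE.
suff : 0 <= 2 + a by lra.
rewrite -(pmulr_lge0 _ g_gt0) -starE.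
by apply: sumr_ge0 => x _; exact: sqr_ge0.
Qed.

(** A linear map into a space of smaller dimension has a nontrivial kernel. *)
Lemma star_sum_kernel G : (#|G| < #|line_graph G|)%N ->
  exists2 g : line_graph G -> R, (exists E, g E != 0) & star_sum g =1 (fun=> 0).
Proof.
move=> ltGL.
pose B : 'M[R]_(#|line_graph G|, #|G|) :=
  \matrix_(e, i) ((enum_val i : G) \in val (enum_val e : line_graph G))%:R.
have : kermx B != 0.
  by rewrite kermx_eq0 /row_free neq_ltn (leq_ltn_trans (rank_leq_col B) ltGL).
case/rowV0Pn => v /sub_kermxP vB v_neq0.
exists (fun E => v 0 (enum_rank E)).
  apply/existsP; apply: contraNT v_neq0; rewrite negb_exists => /forallP v0.
  apply/eqP/rowP => e; rewrite mxE; apply/eqP.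
  by have := v0 (enum_val e); rewrite enum_valK negbK.
move=> x; move/rowP/(_ (enum_rank x)): vB; rewrite !mxE => <-.
rewrite /star_sum big_mkcond -sum_enum_val; apply: eq_bigr => e _.
by rewrite !mxE enum_rankK enum_valK; case: ifP => _; rewrite ?mulr1 ?mulr0.
Qed.

Lemma min_eigenvalue_line G : (#|G| < #|line_graph G|)%N ->
  min_eigenvalue (adjmx R (line_graph G)) = -2.
Proof.
move=> ltGL; have L_gt0 := leq_ltn_trans (leq0n _) ltGL.
have [eigm lem] := min_eigenvalueP L_gt0 (adjmx_sym R (line_graph G)).
apply/eqP; rewrite eq_le (line_eigenvalue_ge eigm) andbT; apply: lem.
apply/eigenfunctionP; have [g g_neq0 star0] := star_sum_kernel ltGL.
exists g; split => // E; have := end_star_sum g E.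
by rewrite /end_sum big1 // => /esym/eqP; rewrite addrC addr_eq0 mulNr => /eqP.
Qed.

(** The largest eigenvalue of [B B^T] is at most that of [B^T B], here called
    [t]. With [g := B^T u], Rayleigh gives [`|B g|^2 <= t * `|g|^2], and
    [`|g|^2 = <u, B g>]; expanding [0 <= `|t * u - B g|^2] then replaces the
    Cauchy-Schwarz inequality. *)
Lemma sum_end_sqr_le G (u : G -> R) : (0 < #|line_graph G|)%N ->
  \sum_E end_sum u E ^+ 2 <=
    (max_eigenvalue (adjmx R (line_graph G)) + 2) * \sum_x u x ^+ 2.
Proof.
move=> L_gt0; set t := _ + 2.
have t_gt0 : 0 < t by have := max_eigenvalue_ge0 L_gt0; rewrite /t; lra.
pose g := end_sum u.
have starE := sum_star_sqr g; have gA := rayleigh_adj g L_gt0.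
have gE : \sum_E g E ^+ 2 = \sum_x u x * star_sum g x.
  by rewrite -end_star_adj; apply: eq_bigr => E _; rewrite expr2.
have star_le : \sum_x star_sum g x ^+ 2 <= t * \sum_E g E ^+ 2.
  by rewrite starE /t mulrDl; lra.
have : 0 <= \sum_x (t * u x - star_sum g x) ^+ 2.
  by apply: sumr_ge0 => x _; exact: sqr_ge0.
have -> : \sum_x (t * u x - star_sum g x) ^+ 2 =
    t * (t * \sum_x u x ^+ 2 - 2 * \sum_E g E ^+ 2) + \sum_x star_sum g x ^+ 2.
  rewrite gE mulrBr !mulr_sumr -sumrB -big_split.
  by apply: eq_bigr => x _ /=; ring.
move=> sq_ge0; rewrite -subr_ge0 -(pmulr_rge0 _ t_gt0).
by rewrite -/g; lra.
Qed.

Lemma sum_adj_sqr_le G (u : G -> R) : (0 < #|line_graph G|)%N ->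
  \sum_x \sum_(y | adj x y) (u x + u y) ^+ 2 <=
    2 * (max_eigenvalue (adjmx R (line_graph G)) + 2) * \sum_x u x ^+ 2.
Proof.
by move=> L_gt0; rewrite -sum_end_sqr -mulrA ler_pM2l ?ltr0n // sum_end_sqr_le.
Qed.

Lemma sum_adj_prod G (u : G -> R) a : adj_sum u =1 (fun x => a * u x) ->
  \sum_x \sum_(y | adj x y) u x * u y = a * \sum_x u x ^+ 2.
Proof.
move=> uA; rewrite -(eigenfunction_dot uA); apply: eq_bigr => x _.
by rewrite mulr_sumr.
Qed.

Lemma eigenvalue_le_line G a : (0 < #|line_graph G|)%N ->
  eigenvalue (adjmx R G) a ->
  2 * a <= max_eigenvalue (adjmx R (line_graph G)) + 2.
Proof.
move=> L_gt0 /eigenfunctionP[u [/sum_sqr_gt0 u_gt0 uA]].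
set t := _ + 2; have le_t := sum_adj_sqr_le u L_gt0; rewrite -/t in le_t.
have : 4 * \sum_x \sum_(y | adj x y) u x * u y <=
    \sum_x \sum_(y | adj x y) (u x + u y) ^+ 2.
  rewrite mulr_sumr; apply: ler_sum => x _; rewrite mulr_sumr.
  by apply: ler_sum => y _; have := sqr_ge0 (u x - u y); lra.
rewrite (sum_adj_prod uA) => le4; rewrite -(ler_pM2r u_gt0); lra.
Qed.

(** [(`|a| + `|b|) ^+ 2] is at least [4 * `|a| * `|b|] by the inequality of
    arithmetic and geometric means; the sum vanishes only for [`|a| = `|b|] and
    opposite signs. *)
Lemma abs_sum_sqr_ge0 (a b : R) : 0 <= (`|a| + `|b|) ^+ 2 + 4 * (a * b).
Proof.
have := sqr_ge0 (`|a| - `|b|); have := ler_norm (- (a * b)).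
by rewrite normrN normrM; lra.
Qed.

Lemma abs_sum_sqr_eq0 (a b : R) :
  (`|a| + `|b|) ^+ 2 + 4 * (a * b) = 0 -> b = - a.
Proof.
have := sqr_ge0 (`|a| - `|b|); have := ler_norm (- (a * b)).
rewrite normrN normrM => le_ab sq_ge0 ab0.
have ab : `|a| * `|b| = - (a * b) by lra.
have : (a + b) ^+ 2 = 0.
  have := real_normK (num_real a); have := real_normK (num_real b).
  have : `|a| ^+ 2 + `|b| ^+ 2 + 2 * (a * b) = 0 by lra.
  by move=> + b2 a2; rewrite a2 b2; lra.
by move/eqP; rewrite sqrf_eq0 addr_eq0 => /eqP ->; rewrite opprK.
Qed.

Section LeastEigenvalue.
Variables (G : sgraph) (u : G -> R) (a : R).
Hypotheses (L_gt0 : (0 < #|line_graph G|)%N).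
Hypotheses (u_neq0 : exists x, u x != 0) (uA : adj_sum u =1 (fun x => a * u x)).
Local Notation t := (max_eigenvalue (adjmx R (line_graph G)) + 2).

(** Taking absolute values turns the signless bound for [`|u|] into a bound on
    [- a], and keeps the defect of the inequality as a sum of nonnegative terms
    over the edges. *)
Lemma sum_abs_defect_le :
  \sum_x \sum_(y | adj x y) ((`|u x| + `|u y|) ^+ 2 + 4 * (u x * u y)) <=
    2 * (t + 2 * a) * \sum_x u x ^+ 2.
Proof.
have le_t := sum_adj_sqr_le (fun x => `|u x|) L_gt0.
under eq_bigr do rewrite big_split -mulr_sumr.
rewrite big_split -mulr_sumr (sum_adj_prod uA) /=.
have -> : \sum_x u x ^+ 2 = \sum_x `|u x| ^+ 2.
  by apply: eq_bigr => x _; rewrite real_normK ?num_real.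
by lra.
Qed.

Lemma eigenvalue_ge_line : - (2 * a) <= t.
Proof.
suff : 0 <= t + 2 * a by lra.
rewrite -(pmulr_lge0 _ (sum_sqr_gt0 u_neq0)) -(pmulr_rge0 _ (ltr0Sn R 1)) mulrA.
apply: le_trans sum_abs_defect_le.
by do 2!apply: sumr_ge0 => ? _; exact: abs_sum_sqr_ge0.
Qed.

(** In the equality case the defect is zero, hence so is each of its terms. *)
Lemma adj_opposite : - (2 * a) = t -> forall x y, adj x y -> u y = - u x.
Proof.
move=> at_eq; have := sum_abs_defect_le.
rewrite -at_eq addNr mulr0 mul0r => le0 x y xy.
have ge0 z : 0 <= \sum_(w | adj z w) ((`|u z| + `|u w|) ^+ 2 + 4 * (u z * u w)).
  by apply: sumr_ge0 => w _; exact: abs_sum_sqr_ge0.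
have eq0 : \sum_x \sum_(y | adj x y) ((`|u x| + `|u y|) ^+ 2 + 4 * (u x * u y)) = 0.
  by apply/eqP; rewrite eq_le le0 sumr_ge0.
have /psumr_eq0P/(_ y xy) :
    \sum_(w | adj x w) ((`|u x| + `|u w|) ^+ 2 + 4 * (u x * u w)) = 0.
  by apply: (psumr_eq0P _ eq0).
by move/(_ (fun w _ => abs_sum_sqr_ge0 _ _))/abs_sum_sqr_eq0.
Qed.

End LeastEigenvalue.

(** Propagation along paths makes [`|u|] a nonzero constant, so the neighbours of
    [x] contribute [- deg x * u x] to the eigenvalue equation, and the set where
    [u] is positive is a colour class. *)
Lemma opposite_regular_bipartite G (u : G -> R) a :
  connected G -> (exists x, u x != 0) -> adj_sum u =1 (fun x => a * u x) ->
  (forall x y, adj x y -> u y = - u x) -> regular G /\ bipartite G.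
Proof.
move=> G_conn [x0 ux0] uA uN.
have norm_u x : `|u x| = `|u x0|.
  have /connectP[p] := G_conn x0 x.
  elim/last_ind: p x => [|p y IHp] x /=; first by move=> _ ->.
  rewrite rcons_path last_rcons => /andP[p_path py] ->.
  by rewrite (uN _ _ py) normrN (IHp _ p_path erefl).
have u_neq0 x : u x != 0 by rewrite -normr_eq0 norm_u normr_eq0.
have deg (x : G) : #|[set y | adj x y]|%:R = - a.
  apply: (mulIf (u_neq0 x)); rewrite mulNr -uA /adj_sum.
  rewrite (eq_bigr (fun=> - u x)) => [|y /uN //].
  rewrite sumr_const mulNrn opprK mulr_natl.
  by congr (_ *+ _); apply: eq_card => y; rewrite inE.
split.
  exists #|[set y | adj x0 y]| => x.
  by apply/eqP; rewrite -(eqr_nat R) !deg.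
exists [set x | 0 < u x] => x y xy; rewrite !inE (uN _ _ xy) oppr_gt0.
by case: ltgtP (u_neq0 x).
Qed.

Section RegularGraph.
Variables (G : sgraph) (k : nat).
Hypothesis regG : forall x : G, #|[set y | adj x y]| = k.

Lemma sum_adj_const (c : R) (x : G) : \sum_(y | adj x y) c = k%:R * c.
Proof.
rewrite sumr_const mulr_natl -(regG x); congr (_ *+ _).
by apply: eq_card => y; rewrite inE.
Qed.

(** In matrix form: [k + A(G) <= 2 * k], because the Laplacian [k - A(G)] is
    positive semidefinite. *)
Lemma regular_sum_adj_sqr_le (s : G -> R) :
  \sum_x \sum_(y | adj x y) (s x + s y) ^+ 2 <= 4 * k%:R * \sum_x s x ^+ 2.
Proof.
have sum_l : \sum_x \sum_(y | adj x y) s x ^+ 2 = k%:R * \sum_x s x ^+ 2.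
  by rewrite mulr_sumr; apply: eq_bigr => x _; rewrite sum_adj_const.
have sum_r : \sum_x \sum_(y | adj x y) s y ^+ 2 = k%:R * \sum_x s x ^+ 2.
  rewrite (exchange_big_dep xpredT) //= -sum_l.
  by apply: eq_bigr => y _; apply: eq_bigl => x; rewrite adj_sym.
have -> : 4 * k%:R * \sum_x s x ^+ 2 =
    \sum_x \sum_(y | adj x y) 2 * (s x ^+ 2 + s y ^+ 2).
  transitivity (2 * (k%:R * \sum_x s x ^+ 2 + k%:R * \sum_x s x ^+ 2)); first by ring.
  rewrite -{1}sum_l -sum_r -big_split mulr_sumr; apply: eq_bigr => x _.
  by rewrite -mulr_sumr big_split.
apply: ler_sum => x _; apply: ler_sum => y _.
by have := sqr_ge0 (s x - s y); lra.
Qed.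

(** If [B^T B g = t * g] and [s := B g], then [`|B^T s|^2 = t^2 * `|g|^2] and
    [`|s|^2 = t * `|g|^2], so the bound [`|B^T s|^2 <= 2 * k * `|s|^2] gives
    [t^2 <= 2 * k * t]. *)
Lemma regular_max_eigenvalue_line : (0 < #|line_graph G|)%N ->
  max_eigenvalue (adjmx R (line_graph G)) + 2 <= 2 * k%:R.
Proof.
move=> L_gt0; have max_ge0 := max_eigenvalue_ge0 L_gt0.
have [/eigenfunctionP[g [/sum_sqr_gt0 g_gt0 gA]] _] :=
  max_eigenvalueP L_gt0 (adjmx_sym R (line_graph G)).
move: (max_eigenvalue _) max_ge0 gA => mu mu_ge0 gA.
have starE := sum_star_sqr g; rewrite (eigenfunction_dot gA) in starE.
have endE : \sum_E end_sum (star_sum g) E ^+ 2 = (mu + 2) ^+ 2 * \sum_E g E ^+ 2.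
  by rewrite mulr_sumr; apply: eq_bigr => E _; rewrite end_star_sum gA; ring.
have := regular_sum_adj_sqr_le (star_sum g); rewrite -sum_end_sqr endE starE => le_k.
have t_gt0 : 0 < mu + 2 by lra.
rewrite -(ler_pM2l t_gt0) -(ler_pM2r g_gt0); lra.
Qed.

Lemma regular_eigenvalue : (0 < #|G|)%N -> eigenvalue (adjmx R G) k%:R.
Proof.
move=> /card_gt0P[x0 _]; apply/eigenfunctionP; exists (fun=> 1); split.
  by exists x0; rewrite oner_neq0.
by move=> x; exact: sum_adj_const.
Qed.

Lemma regular_bipartite_eigenvalue :
  (0 < #|G|)%N -> bipartite G -> eigenvalue (adjmx R G) (- k%:R).
Proof.
move=> /card_gt0P[x0 _] [A AP]; apply/eigenfunctionP.
exists (fun x => (-1) ^+ (x \in A)); split; first by exists x0; rewrite signr_eq0.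
move=> x; rewrite mulNr -mulrN -(sum_adj_const _ x); apply: eq_bigr => y /AP.
by do 2!case: (_ \in A); rewrite // ?expr1 ?expr0 ?opprK.
Qed.

End RegularGraph.

End Spectra.

Theorem proposition7 (R : realType) (n m : nat) (G : sgraph)
    (n_ge4 : (4 <= n)%N) (m_gtn : (n < m)%N)
    (G_n : #|G| = n) (G_m : #|edges G| = m) (G_conn : connected G) :
  spread R G <= spread R (line_graph G) /\
  (spread R G = spread R (line_graph G) <-> regular G /\ bipartite G).
Proof.
have G_gt0 : (0 < #|G|)%N by rewrite G_n; apply: leq_trans n_ge4.
have ltGL : (#|G| < #|line_graph G|)%N by rewrite card_line_graph G_n G_m.
have L_gt0 := leq_ltn_trans (leq0n _) ltGL.
have [eigM leM] := max_eigenvalueP G_gt0 (adjmx_sym R G).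
have [/eigenfunctionP[u [u_neq0 uA]] gem] := min_eigenvalueP G_gt0 (adjmx_sym R G).
have max_le := eigenvalue_le_line L_gt0 eigM.
have min_ge := eigenvalue_ge_line L_gt0 u_neq0 uA.
rewrite /spread (min_eigenvalue_line R ltGL).
split; first by lra.
split=> [eq_spread|[[k regG] bipG]].
  apply: (opposite_regular_bipartite G_conn u_neq0 uA).
  by apply: (adj_opposite L_gt0 uA); lra.
have := leM _ (regular_eigenvalue R regG G_gt0).
have := gem _ (regular_bipartite_eigenvalue R regG G_gt0 bipG).
have := regular_max_eigenvalue_line R regG L_gt0.
lra.
Qed.
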